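(* Let $n\ge3$ and $k=2$. Let $A\subset V^\ast\otimes_{\mathbb R}\mathbb S$ be the tableau (at any point) of the parabolic $2$-Dirac operator $D=(D_1,D_2)$. Then the tableau of its first prolongation, i.e. $A^{(1)}$ regarded as a tableau in $V^\ast\otimes_{\mathbb R}A$, is involutive.
   Context: Spinors: $\varepsilon_1,\dots,\varepsilon_n$ is an orthonormal basis of Euclidean $\mathbb R^n$, with Clifford relations $\varepsilon_\alpha\varepsilon_\beta+\varepsilon_\beta\varepsilon_\alpha=-2\delta_{\alpha\beta}$. $\mathbb S$ is the complex spinor module of $\mathfrak{so}(n)$: the unique spinor module if $n$ is odd, and the direct sum $\mathbb S_+\oplus\mathbb S_-$ of the two half-spinor modules if $n$ is even; $\mathbb R^n$ acts on it by Clifford multiplication. Operator: let $\mathcal U=M(n,k,\mathbb R)\times A(k,\mathbb R)$, where $M(n,k,\mathbb R)$ is the space of real $n\times k$ matrices with coordinates $x_{\alpha i}$ and $A(k,\mathbb R)$ is the space of skew-symmetric $k\times k$ matrices with coordinates $y_{rs}=-y_{sr}$. Write $\partial_{\alpha i}=\partial/\partial x_{\alpha i}$, $\partial_{rs}=\partial/\partial y_{rs}$, $\partial_{rs}=-\partial_{sr}$. The left invariant vector fields are $L_{\alpha i}=\partial_{\alpha i}-\frac12\sum_j x_{\alpha j}\partial_{ij}$; they satisfy $[L_{\alpha i},L_{\beta j}]=\delta_{\alpha\beta}\partial_{ij}$. The parabolic $k$-Dirac operator is $D=(D_1,\dots,D_k)$, $D_i\psi=\sum_{\alpha=1}^n\varepsilon_\alpha\cdot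 L_{\alpha i}\psi$, for $\mathbb S$-valued functions $\psi$ on $\mathcal U$. Tableau of the operator: $\omega_{\alpha i}$, $\omega_{rs}$ ($r<s$) is the coframe on $\mathcal U$ dual to the frame $L_{\alpha i},\partial_{rs}$ ($r<s$). At any point, $V^\ast$ is the cotangent space of $\mathcal U$, with basis $\omega_{\alpha i},\omega_{rs}$ ($r<s$), so $\dim V^\ast=nk+\binom k2$. The tableau is $A=\{\sum_{\alpha,i}\omega_{\alpha i}\otimes\psi_{\alpha i}+\sum_{r<s}\omega_{rs}\otimes\chi_{rs}:\ \psi_{\alpha i},\chi_{rs}\in\mathbb S,\ \sum_\alpha\varepsilon_\alpha\cdot\psi_{\alpha i}=0\text{ for every }i\}\subset V^\ast\otimes_{\mathbb R}\mathbb S$. Its first prolongation is $A^{(1)}=(S^2V^\ast\otimes\mathbb S)\cap(V^\ast\otimes A)$. Involutivity: a tableau is a complex subspace $B\subset V^\ast\otimes_{\mathbb R} W$, where $V^\ast$ is a real vector space of dimension $N$ and $W$ is a finite-dimensional complex vector space; all dimensions of tableaux are complex. Its first prolongation is $B^{(1)}=(S^2V^\ast\otimes W)\cap(V^\ast\otimes B)$. For an ordered basis $u^1,\dots,u^N$ of $V^\ast$ put $B_j=B\cap(\langle u^{j+1},\dots,u^N\rangle\otimes W)$. One always has $\dim B^{(1)}\le\dim B+\dim B_1+\dots+\dim B_{N-1}$, and $B$ is called involutive if equality holds for some ordered basis of $V^\ast$. *)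

(* Defs.v *)
From HB Require Import structures.
From mathcomp Require Import all_boot all_order all_algebra.
From mathcomp Require Import complex reals.

Set Implicit Arguments.
Unset Strict Implicit.
Unset Printing Implicit Defensive.

Import Order.TTheory GRing.Theory Num.Theory.
Local Open Scope ring_scope.

(* Conventions.  A real vector space V^* with a distinguished basis indexed by
   the finite type I is {ffun I -> R^o}; for a complex vector space W, the
   tensor product of V^* and W over R is then {ffun I -> W}, the function f
   standing for the sum over i of (basis vector i) (x) f i.  In V^* (x) V^* (x) W
   = {ffun I -> {ffun I -> W}} the outer index is the first factor. *)

Section Tableaux.

Variables (R : realType) (I : finType).

Section TensorPowers.

Variable W : vectType R[i].

(* The pure tensor u (x) w, for a real covector u. *)
Definition pure_tensor (u : {ffun I -> R^o}) (w : W) : {ffun I -> W} :=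
  [ffun i => real_complex R (u i) *: w].

Fact pure_tensor_is_linear u : linear (pure_tensor u).
Proof.
by move=> a v w; apply/ffunP => i; rewrite !ffunE scalerDr !scalerA mulrC.
Qed.

HB.instance Definition _ u :=
  GRing.isLinear.Build R[i] W {ffun I -> W} *:%R (pure_tensor u)
    (pure_tensor_is_linear u).

(* <s> (x) W, where <s> is the real span of the covectors in s. *)
Definition span_tensor (s : seq {ffun I -> R^o}) : {vspace {ffun I -> W}} :=
  (\sum_(u <- s) limg (linfun (pure_tensor u)))%VS.

Definition antisym (T : {ffun I -> {ffun I -> W}}) : {ffun I -> {ffun I -> W}} :=
  [ffun i => [ffun j => T i j - T j i]].

Fact antisym_is_linear : linear antisym.
Proof.
move=> a T T'; apply/ffunP => i; apply/ffunP => j.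
by rewrite !ffunE scalerBr opprD addrACA.
Qed.

HB.instance Definition _ :=
  GRing.isLinear.Build R[i] _ _ *:%R antisym antisym_is_linear.

(* S^2 V^* (x) W *)
Definition sym2_tensor : {vspace {ffun I -> {ffun I -> W}}} :=
  lker (linfun antisym).

End TensorPowers.

(* The inclusion of V^* (x) B into V^* (x) U, for a subspace B of U. *)
Definition tensor_incl (U : vectType R[i]) (B : {vspace U})
    (T : {ffun I -> subvs_of B}) : {ffun I -> U} :=
  [ffun i => vsval (T i)].

Fact tensor_incl_is_linear (U : vectType R[i]) (B : {vspace U}) :
  linear (@tensor_incl U B).
Proof. by move=> a T T'; apply/ffunP => i; rewrite !ffunE linearP. Qed.

HB.instance Definition _ (U : vectType R[i]) (B : {vspace U}) :=
  GRing.isLinear.Build R[i] _ _ *:%R (@tensor_incl U B)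
    (@tensor_incl_is_linear U B).

(* V^* (x) B as a subspace of V^* (x) U *)
Definition tensor_sub (U : vectType R[i]) (B : {vspace U}) :
    {vspace {ffun I -> U}} :=
  limg (linfun (@tensor_incl U B)).

(* B^(1), a subspace of V^* (x) V^* (x) W *)
Definition prolongation (W : vectType R[i]) (B : {vspace {ffun I -> W}}) :
    {vspace {ffun I -> {ffun I -> W}}} :=
  (sym2_tensor W :&: tensor_sub B)%VS.

(* B^(1) regarded as a tableau in V^* (x) B *)
Definition prolongation_tableau (W : vectType R[i])
    (B : {vspace {ffun I -> W}}) : {vspace {ffun I -> subvs_of B}} :=
  (linfun (@tensor_incl _ B) @^-1: prolongation B)%VS.

(* Sequences are numbered from 0, so [drop j u] is u^{j+1}, ..., u^N. *)
Definition flag_part (W : vectType R[i]) (B : {vspace {ffun I -> W}})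
    (u : seq {ffun I -> R^o}) (j : nat) : {vspace {ffun I -> W}} :=
  (B :&: span_tensor W (drop j u))%VS.

(* All dimensions of subspaces of {ffun I -> W} are over R[i], whereas u is a
   basis of {ffun I -> R^o} over R. *)
Definition involutive_tableau (W : vectType R[i])
    (B : {vspace {ffun I -> W}}) : Prop :=
  exists2 u : seq {ffun I -> R^o}, basis_of fullv u &
    \dim (prolongation B) =
      (\dim B + \sum_(1 <= j < #|I|) \dim (flag_part B u j))%N.

Lemma mem_sym2_tensor (W : vectType R[i]) (T : {ffun I -> {ffun I -> W}}) :
  T \in sym2_tensor W <-> forall i j, T i j = T j i.
Proof.
rewrite memv_ker lfunE /=; split=> [/eqP T0 i j | symT].
  have /ffunP/(_ i)/ffunP/(_ j) := T0.
  by rewrite !ffunE => /eqP; rewrite subr_eq0 => /eqP.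
apply/eqP/ffunP => i; apply/ffunP => j.
by rewrite !ffunE (symT i j) subrr.
Qed.

Lemma mem_tensor_sub (U : vectType R[i]) (B : {vspace U}) (T : {ffun I -> U}) :
  T \in tensor_sub B <-> forall i, T i \in B.
Proof.
split=> [/memv_imgP[T' _ ->] i | BT].
  by rewrite lfunE /= ffunE subvsP.
apply/memv_imgP; exists [ffun i => vsproj B (T i)]; first exact: memvf.
by apply/ffunP => i; rewrite lfunE /= !ffunE vsprojK.
Qed.

Lemma mem_prolongation_tableau (W : vectType R[i])
    (B : {vspace {ffun I -> W}}) (T : {ffun I -> subvs_of B}) :
  T \in prolongation_tableau B <->
  forall i j, vsval (T i) j = vsval (T j) i.
Proof.
rewrite -memv_preim lfunE /= memv_cap.
have -> : tensor_incl T \in tensor_sub B.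
  by apply/mem_tensor_sub => i; rewrite ffunE subvsP.
rewrite andbT mem_sym2_tensor.
by split=> symT i j; move: (symT i j); rewrite !ffunE.
Qed.

End Tableaux.

Section Dirac.

Variables (R : realType) (n : nat).

(* S, with Clifford multiplication by the orthonormal basis e_1, ..., e_n, is
   an irreducible complex module over the Clifford algebra of R^n.  With so(n)
   acting through the products e_a e_b / 2 (a <> b), it is the spinor module
   for n odd and the sum of the two half-spinor modules for n even.
   For n odd there are two such Clifford multiplications on the spinor module,
   exchanged by e |-> - e; both are covered. *)
Definition spinor_module (S : vectType R[i]) (e : 'I_n -> 'End(S)) : Prop :=
  [/\ forall (a b : 'I_n) (s : S),
        e a (e b s) + e b (e a s) = (- 2 * (a == b)%:R) *: s,
      (fullv : {vspace S}) <> 0%VS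
    & forall U : {vspace S}, (forall a, (e a @: U <= U)%VS) ->
        U = 0%VS \/ U = fullv].

Variable k : nat.

(* Indices of the coframe: inl (a, i) stands for omega_{a i}, and inr of the
   pair (r, s), r < s, for omega_{r s}. *)
Definition coframe : finType :=
  (('I_n * 'I_k) + {p : 'I_k * 'I_k | (p.1 < p.2)%N})%type.

Variables (S : vectType R[i]) (e : 'I_n -> 'End(S)).

Definition dirac_symbol (i : 'I_k) (psi : {ffun coframe -> S}) : S :=
  \sum_a e a (psi (inl (a, i))).

Fact dirac_symbol_is_linear i : linear (dirac_symbol i).
Proof.
move=> c psi psi'; rewrite /dirac_symbol scaler_sumr -big_split /=.
by apply: eq_bigr => a _; rewrite !ffunE linearP.
Qed.

HB.instance Definition _ i :=
  GRing.isLinear.Build R[i] _ _ *:%R (dirac_symbol i)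
    (dirac_symbol_is_linear i).

(* The coefficients psi (inr _) along the omega_{r s} are unconstrained. *)
Definition dirac_tableau : {vspace {ffun coframe -> S}} :=
  (\bigcap_i lker (linfun (dirac_symbol i)))%VS.

Lemma mem_dirac_tableau psi :
  psi \in dirac_tableau <-> forall i, \sum_a e a (psi (inl (a, i))) = 0.
Proof.
split=> [/subv_bigcapP psiA i | psi0].
  by have := psiA i isT; rewrite -memvE memv_ker lfunE => /eqP.
apply/subv_bigcapP => i _.
by rewrite -memvE memv_ker lfunE /= /dirac_symbol psi0.
Qed.

End Dirac.

(* Main.v *)
From HB Require Import structures.
Require Import Defs.
From mathcomp Require Import all_boot all_order all_algebra.
From mathcomp Require Import complex reals zify.
Import Order.TTheory GRing.Theory Num.Theory.
Local Open Scope ring_scope.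

Set Implicit Arguments.
Unset Strict Implicit.
Unset Printing Implicit Defensive.

(** Elements of the successive prolongations of the Dirac tableau A are
    homogeneous S-valued polynomial solutions, of degree 1, 2 and 3, of the two
    constant coefficient Dirac equations D_1 f = D_2 f = 0, in the N variables
    dual to the coframe.  For a basis u of the covectors let c_d(j) be the
    dimension of the space of solutions of degree d in the variables
    u^{j+1}, ..., u^N only; involutivity of the first prolongation means
    c_3(0) = sum_j c_2(j).  Put s = dim S and N = m + 3.

    Upper bound.  Differentiation in the direction dual to u^{j+1} gives
    c_{d+1}(j) <= c_{d+1}(j+1) + c_d(j) ([dim_flag_prolongation], Cartan's
    inequality) and c_1(j) <= c_1(j+1) + s.  The last three covectors are chosen
    as omega_{2,1} + omega_{3,2}, omega_{1,1}, omega_{1,2}.  There is no linear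
    solution in the last two of them, because Clifford multiplication by a unit
    vector is invertible.  For f quadratic in all three, with derivatives f_u,
    f_v, f_w along the dual directions, the equations read f_v = e_1 e_2 f_u and
    f_w = e_1 e_3 f_u; equality of the mixed derivatives f_vw and f_wv then says
    that f_uu is killed by the commutator of e_1 e_2 and e_1 e_3, which is
    invertible ([clifford_commutator_inj]), so f = 0
    ([prolongation_dirac_tail3]).  This is where n >= 3 enters.  Hence
    2 c_2(m - k) <= k (k + 3) s for k <= m, c_2(j) = 0 for j >= m, and
    c_3(0) <= sum_j c_2(j) <= m (m + 1) (m + 5) s / 6.

    Lower bound.  The right hand sides g_i = D_i f of the Dirac equations
    satisfy D_1 D_1 g_2 = D_2 D_1 g_1 and D_2 D_2 g_1 = D_1 D_2 g_2, because
    D_1 D_1 and D_2 D_2 are scalar Laplace operators.  On pairs of quadratic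
    g_i these conditions form a surjection onto S^2 ([dirac_compat_surj]), so
    the Dirac operator on cubic polynomials has rank at most
    2 (s C(N+1, 2) - s), and c_3(0) >= s (C(N+2, 3) - 2 C(N+1, 2) + 2).  This
    number is exactly m (m + 1) (m + 5) s / 6, and all the inequalities are
    equalities. *)

(** * Contractions with a dual basis and Cartan's inequality *)

Lemma dim_ffun (K : fieldType) (T : finType) (W : vectType K) :
  \dim (fullv : {vspace {ffun T -> W}}) = (#|T| * \dim (fullv : {vspace W}))%N.
Proof. by rewrite !dimvf. Qed.

Section Contraction.

Variables (R : realType) (I : finType).
Implicit Type W : vectType R[i].

Definition delta (x : I) : {ffun I -> R^o} := [ffun y => (y == x)%:R].

Lemma covector_sum_delta (g : {ffun I -> R^o}) :
  g = \sum_x (g x : R) *: delta x.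
Proof.
apply/ffunP => y; rewrite sum_ffunE (bigD1 y) //= !ffunE eqxx.
rewrite big1 ?addr0 /= => [|x neq_xy]; first by rewrite /GRing.scale /= mulr1.
by rewrite !ffunE eq_sym (negPf neq_xy) scaler0.
Qed.

Definition contract W (v : I -> R) (T : {ffun I -> W}) : W :=
  \sum_x real_complex R (v x) *: T x.

Fact contract_is_linear W v : linear (@contract W v).
Proof.
move=> a T T'; rewrite /contract scaler_sumr -big_split /=.
by apply: eq_bigr => x _; rewrite !ffunE scalerDr !scalerA mulrC.
Qed.

HB.instance Definition _ W v :=
  GRing.isLinear.Build R[i] _ _ *:%R (@contract W v) (@contract_is_linear W v).

Lemma contract_ffunE (T : finType) W (v : I -> R)
    (F : {ffun I -> {ffun T -> W}}) y :
  contract v F y = \sum_x real_complex R (v x) *: F x y.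
Proof. by rewrite sum_ffunE; apply: eq_bigr => x _; rewrite ffunE. Qed.

Lemma mem_span_tensor W s (u : {ffun I -> R^o}) (w : W) :
  u \in s -> pure_tensor u w \in span_tensor W s.
Proof.
move=> us; rewrite /span_tensor (big_rem u us) /= memvE.
apply: subv_trans (addvSl _ _); rewrite -memvE.
by apply/memv_imgP; exists w; rewrite ?memvf ?lfunE.
Qed.

Lemma span_tensor_sub W s (V : {vspace {ffun I -> W}}) :
  (forall u w, u \in s -> pure_tensor u w \in V) -> (span_tensor W s <= V)%VS.
Proof.
move=> sV; rewrite /span_tensor big_seq.
apply: (big_ind (fun U : {vspace _} => U <= V)%VS).
- exact: sub0v.
- by move=> U1 U2; rewrite subv_add => -> ->.
- move=> u us; apply/subvP => _ /memv_imgP[w _ ->].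
  by rewrite lfunE; apply: sV.
Qed.

Variables (N : nat) (u : N.-tuple {ffun I -> R^o}).

Definition dual_vec (i : 'I_N) (x : I) : R := coord u i (delta x).

Lemma contract_pure W i v (w : W) :
  contract (dual_vec i) (pure_tensor v w) = real_complex R (coord u i v) *: w.
Proof.
rewrite /contract {2}[v]covector_sum_delta linear_sum rmorph_sum scaler_suml /=.
by apply: eq_bigr => x _; rewrite ffunE scalerA -rmorphM /= mulrC linearZ.
Qed.

Hypothesis basis_u : basis_of fullv u.

(** A tensor is the sum of u^i (x) its contraction with the i-th vector of the
    dual basis. *)
Lemma tensor_decomposition W (T : {ffun I -> W}) :
  T = \sum_(i < N) pure_tensor u`_i (contract (dual_vec i) T).
Proof.
apply/ffunP => y; rewrite sum_ffunE.
under eq_bigr => i _ do rewrite ffunE scaler_sumr.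
rewrite exchange_big /=.
under eq_bigr => x _.
  under eq_bigr => i _ do rewrite scalerA -rmorphM /=.
  rewrite -scaler_suml -rmorph_sum /=.
  have -> : \sum_(i < N) u`_i y * dual_vec i x = delta x y.
    rewrite [in RHS](coord_basis basis_u (memvf (delta x))) sum_ffunE.
    by apply: eq_bigr => i _; rewrite ffunE mulrC.
  rewrite ffunE; over.
rewrite (bigD1 y) //= eqxx rmorph1 scale1r big1 ?addr0 // => x neq_xy.
by rewrite eq_sym (negPf neq_xy) rmorph0 scale0r.
Qed.

(** Equations for the parts of a flag: in the polynomial picture, not depending
    on the first variables means having zero derivatives along the first vectors
    of the dual basis. *)
Lemma span_tensor_dropP W j (T : {ffun I -> W}) :
  reflect (forall i : 'I_N, (i < j)%N -> contract (dual_vec i) T = 0)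
          (T \in span_tensor W (drop j u)).
Proof.
apply: (iffP idP) => [uT i ltij | T0].
  suff /subvP/(_ _ uT): (span_tensor W (drop j u) <=
      lker (linfun (@contract W (dual_vec i))))%VS.
    by rewrite memv_ker lfunE => /eqP.
  apply: span_tensor_sub => v w /(nthP 0)[k].
  rewrite size_drop size_tuple ltn_subRL => ltk <-.
  rewrite memv_ker lfunE /= contract_pure nth_drop.
  rewrite (coord_free (Ordinal ltk)) ?(basis_free basis_u) //.
  by rewrite -val_eqE /= gtn_eqF ?scale0r // ltn_addr.
rewrite [T]tensor_decomposition; apply: memv_suml => i _.
have [ltij | leji] := ltnP i j; first by rewrite T0 // linear0 mem0v.
apply: mem_span_tensor; rewrite -(subnKC leji) -nth_drop mem_nth //.
by rewrite size_drop size_tuple ltn_sub2r // (leq_ltn_trans leji).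
Qed.

Lemma flag_partP W (B : {vspace {ffun I -> W}}) j T :
  reflect (T \in B /\ forall i : 'I_N, (i < j)%N -> contract (dual_vec i) T = 0)
          (T \in flag_part B u j).
Proof.
rewrite memv_cap; apply: (iffP andP) => -[BT].
  by move/span_tensor_dropP.
by move=> T0; split=> //; apply/span_tensor_dropP.
Qed.

Lemma flag_part0 W (B : {vspace {ffun I -> W}}) : flag_part B u 0 = B.
Proof.
apply/vspaceP => T; apply/flag_partP/idP => [[] // | BT].
by split=> // i; rewrite ltn0.
Qed.

Lemma flag_part_anti W (B : {vspace {ffun I -> W}}) j k :
  (j <= k)%N -> (flag_part B u k <= flag_part B u j)%VS.
Proof.
move=> lejk; apply/subvP => T /flag_partP[BT T0]; apply/flag_partP.
by split=> // i ltij; apply: T0; apply: leq_trans lejk.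
Qed.

(** Rank-nullity for the contraction with the i-th dual vector: its kernel in
    the i-th part of the flag is the next part.  The injection [h] lets the
    image be measured in a space other than [W]. *)
Lemma dim_flag_partS W U (B : {vspace {ffun I -> W}}) (C : {vspace U})
    (h : 'Hom(W, U)) (i : 'I_N) :
  lker h = 0%VS ->
  (forall T, T \in flag_part B u i -> h (contract (dual_vec i) T) \in C) ->
  (\dim (flag_part B u i) <= \dim (flag_part B u i.+1) + \dim C)%N.
Proof.
move=> h_inj hC; set V := flag_part B u i.
pose f := (h \o linfun (@contract W (dual_vec i)))%VF.
rewrite -(limg_ker_dim f V); apply: leq_add; apply: dimvS.
  apply/subvP => T; rewrite memv_cap memv_ker => /andP[/flag_partP[BT T0]].
  rewrite lfunE /= lfunE -memv_ker h_inj memv0 => /eqP fT0.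
  apply/flag_partP; split=> // k.
  rewrite ltnS leq_eqVlt => /predU1P[/val_inj->|].
    exact: fT0.
  exact: T0.
by apply/subvP => _ /memv_imgP[T VT ->]; rewrite lfunE /= lfunE; apply: hC.
Qed.

Lemma dim_flag_part_tail W (B : {vspace {ffun I -> W}}) m d :
  (m + d)%N = N -> flag_part B u m = 0%VS -> forall k, (k <= m)%N ->
  (\dim (flag_part B u (m - k)) <= k * \dim (fullv : {vspace W}))%N.
Proof.
move=> defN B0; elim=> [_|k IHk ltkm]; first by rewrite subn0 B0 dimv0.
have ltN : (m - k.+1 < N)%N.
  by rewrite -defN ltn_addr // ltn_subrL /= (leq_trans _ ltkm).
have := @dim_flag_partS _ _ B fullv \1%VF (Ordinal ltN).
rewrite /= -subSn // subSS => /(_ _ _)/leq_trans-> //.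
- apply/eqP; rewrite -subv0; apply/subvP => w.
  by rewrite memv_ker id_lfunE memv0.
- by move=> T _; apply: memvf.
by rewrite mulSn addnC leq_add2l IHk // ltnW.
Qed.

(** Contracting the first factor of a symmetric tensor in V^* (x) B leaves an
    element of B, which inherits the vanishing of earlier contractions by
    symmetry.  This is one step of Cartan's inequality. *)
Lemma dim_flag_prolongation W (B : {vspace {ffun I -> W}}) (i : 'I_N) :
  (\dim (flag_part (prolongation_tableau B) u i) <=
     \dim (flag_part (prolongation_tableau B) u i.+1) +
     \dim (flag_part B u i))%N.
Proof.
apply: (@dim_flag_partS _ _ _ _ (linfun (@vsval _ _ B))) => [|T].
  apply/eqP; rewrite -subv0; apply/subvP => w.
  by rewrite memv_ker lfunE memv0 -(inj_eq val_inj).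
move=> /flag_partP[/mem_prolongation_tableau symT T0]; rewrite lfunE /=.
apply/flag_partP; split=> [|k ltki]; first exact: subvsP.
have tE v : vsval (contract v T) = contract v [ffun x => vsval (T x)].
  rewrite /contract linear_sum; apply: eq_bigr => x _.
  by rewrite ffunE linearZ.
have /(congr1 vsval) := T0 k ltki; rewrite tE linear0 => /ffunP tk0.
rewrite tE /contract.
under eq_bigr => x _ do rewrite contract_ffunE scaler_sumr.
rewrite exchange_big big1 // => y _.
under eq_bigr => x _ do rewrite ffunE symT scalerA mulrC -scalerA.
rewrite -scaler_sumr; have := tk0 y; rewrite contract_ffunE ffunE.
by under eq_bigr => x _ do rewrite ffunE; move=> ->; rewrite scaler0.
Qed.

Lemma dim_flag_prolongation_le_sum W (B : {vspace {ffun I -> W}}) m j :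
  (j + m)%N = N ->
  (\dim (flag_part (prolongation_tableau B) u j) <=
     \sum_(j <= i < N) \dim (flag_part B u i))%N.
Proof.
elim: m j => [|m IHm] j defN.
  rewrite addn0 in defN; rewrite big_geq ?defN // leqn0 dimv_eq0 -subv0.
  apply/subvP => T /flag_partP[_ T0]; rewrite memv0 [T]tensor_decomposition.
  by apply/eqP; rewrite big1 // => i _; rewrite T0 // linear0.
have ltjN : (j < N)%N by rewrite -defN addnS ltnS leq_addr.
rewrite big_ltn //.
apply: leq_trans (dim_flag_prolongation B (Ordinal ltjN)) _ => /=.
by rewrite addnC leq_add2l IHm // addSnnS.
Qed.

End Contraction.

(** * Homogeneous polynomials *)

Section Monomials.

Variable I : finType.

(** Sorted tuples of indices are representatives of the monomials of degree [m]
    in variables indexed by [I]; a function on them is a symmetric tensor, whose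
    entries are its values at [mono]. *)
Definition monomial (m : nat) : finType :=
  {t : m.-tuple 'I_#|I| | sorted leq [seq val i | i <- t]}.

Let le_ord (i j : 'I_#|I|) := (i <= j)%N.

Fact mono_subproof m (t : m.-tuple I) :
  sorted leq [seq val i | i <- [tuple of sort le_ord (map enum_rank t)]].
Proof.
rewrite sorted_map; apply: sort_sorted => i j; exact: leq_total.
Qed.

Definition mono m (t : m.-tuple I) : monomial m :=
  exist (fun t : m.-tuple 'I_#|I| => sorted leq [seq val i | i <- t]) _
    (mono_subproof t).

Definition factors m (x : monomial m) : m.-tuple I :=
  map_tuple enum_val (val x).

Lemma mono_eqP m (s t : m.-tuple I) : reflect (mono s = mono t) (perm_eq s t).
Proof.
have -> : perm_eq s t = perm_eq (map enum_rank s) (map enum_rank t).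
  apply/idP/idP => [|st]; first exact: perm_map.
  have rankK : cancel (@enum_rank I) enum_val := @enum_rankK I.
  by rewrite -[val s](mapK rankK) -[val t](mapK rankK) perm_map.
have le_ord_total : total le_ord by move=> i j; apply: leq_total.
have le_ord_trans : transitive le_ord by move=> i j k; apply: leq_trans.
have le_ord_anti : antisymmetric le_ord.
  by move=> i j leij; apply/val_inj/anti_leq.
apply: (iffP (perm_sortP le_ord_total le_ord_trans le_ord_anti _ _)).
  by move=> st; apply/val_inj/val_inj.
by case.
Qed.

Lemma factorsK m : cancel (@factors m) (@mono m).
Proof.
move=> x; apply/val_inj/val_inj => /=; rewrite -map_comp map_id_in => [|i _].
  apply: sorted_sort; first by move=> i j k; apply: leq_trans.
  by rewrite -sorted_map (valP x).
exact: enum_valK.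
Qed.

Lemma perm_factors m (t : m.-tuple I) : perm_eq (factors (mono t)) t.
Proof. by apply/mono_eqP; rewrite factorsK. Qed.

Lemma mono_consE m x (t : m.-tuple I) :
  mono [tuple of x :: factors (mono t)] = mono [tuple of x :: t].
Proof. by apply/mono_eqP; rewrite /= perm_cons perm_factors. Qed.

Lemma card_monomial m : (0 < #|I|)%N -> #|{: monomial m}| = 'C(m + #|I|.-1, m).
Proof.
move=> I_gt0; rewrite card_sig.
case: #|I| I_gt0 => // N _.
by rewrite -card_sorted_tuples cardsE; apply: eq_card => t; rewrite inE.
Qed.

End Monomials.

(** * Cubic solutions of the Dirac equations: lower bound *)

Section DiracPolynomials.

Variables (R : realType) (n : nat) (S : vectType R[i]) (e : 'I_n -> 'End(S)).
Hypothesis cliff : forall (a b : 'I_n) (s : S),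
  e a (e b s) + e b (e a s) = (- 2 * (a == b)%:R) *: s.

Local Notation I := (coframe n 2).
Local Notation A := (dirac_tableau 2 e).
Local Notation s := (\dim (fullv : {vspace S})).
Local Notation om i a := (inl (a, i) : I).

Lemma mul2_inj (v w : S) : 2 *: v = 2 *: w -> v = w.
Proof. by apply: scalerI; rewrite pnatr_eq0. Qed.

Lemma clifford_sqr a v : e a (e a v) = - v.
Proof.
have := cliff a a v; rewrite eqxx mulr1 -mulr2n -scaler_nat scaleNr -scalerN.
exact: mul2_inj.
Qed.

Lemma clifford_anticomm a b v : a != b -> e a (e b v) = - e b (e a v).
Proof.
move=> neq_ab; have := cliff a b v.
by rewrite (negPf neq_ab) mulr0 scale0r => /eqP; rewrite addr_eq0 => /eqP.
Qed.

(** D_i D_i is minus a Laplace operator: only the trace of a symmetric array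
    survives Clifford multiplication on both sides. *)
Lemma clifford_trace (F : 'I_n -> 'I_n -> S) :
  (forall a b, F a b = F b a) ->
  \sum_a \sum_b e a (e b (F a b)) = - \sum_a F a a.
Proof.
move=> symF; apply: mul2_inj; rewrite [LHS]scaler_nat mulr2n.
rewrite {2}exchange_big /= -big_split /= scalerN scaler_sumr -sumrN.
apply: eq_bigr => a _; rewrite -big_split /= (bigD1 a) //= cliff eqxx mulr1.
rewrite scaleNr big1 ?addr0 // => b neq_ba.
by rewrite (symF b a) cliff eq_sym (negPf neq_ba) mulr0 scale0r.
Qed.

Lemma clifford2_linear c (F G : 'I_n -> 'I_n -> S) :
  \sum_a \sum_b e a (e b (c *: F a b + G a b)) =
  c *: (\sum_a \sum_b e a (e b (F a b))) + \sum_a \sum_b e a (e b (G a b)).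
Proof.
rewrite scaler_sumr -big_split /=; apply: eq_bigr => a _.
rewrite scaler_sumr -big_split /=; apply: eq_bigr => b _.
by rewrite !linearP.
Qed.

(** Up to the normalization of symmetric tensors, f |-> (D_1 f, D_2 f) on cubic
    polynomials. *)
Definition dirac_cubic (f : {ffun monomial I 3 -> S}) :
    {ffun 'I_2 -> {ffun monomial I 2 -> S}} :=
  [ffun i => [ffun t => \sum_c e c (f (mono [tuple of om i c :: factors t]))]].

Fact dirac_cubic_is_linear : linear dirac_cubic.
Proof.
move=> c f f'; apply/ffunP => i; apply/ffunP => t; rewrite !ffunE.
rewrite scaler_sumr -big_split /=.
by apply: eq_bigr => a _; rewrite !ffunE linearP.
Qed.

HB.instance Definition _ :=
  GRing.isLinear.Build R[i] _ _ *:%R dirac_cubic dirac_cubic_is_linear.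

(** The compatibility operator: with j the index other than i, its i-th
    component is D_i D_i g_j - D_j D_i g_i. *)
Definition dirac_compat (g : {ffun 'I_2 -> {ffun monomial I 2 -> S}}) :
    {ffun 'I_2 -> S} :=
  [ffun i => \sum_a \sum_b
     e a (e b (g (rev_ord i) (mono [tuple om i a; om i b])
             - g i (mono [tuple om (rev_ord i) a; om i b])))].

Fact dirac_compat_is_linear : linear dirac_compat.
Proof.
move=> c g g'; apply/ffunP => i; rewrite [RHS]ffunE.
rewrite [X in _ = X + _]ffunE [LHS]ffunE.
rewrite [dirac_compat g i]ffunE [dirac_compat g' i]ffunE.
rewrite -clifford2_linear; apply: eq_bigr => a _; apply: eq_bigr => b _.
by congr (e a (e b _)); rewrite !ffunE opprD addrACA -scalerBr.
Qed.

HB.instance Definition _ :=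
  GRing.isLinear.Build R[i] _ _ *:%R dirac_compat dirac_compat_is_linear.

Lemma dirac_cubicE f i x y :
  dirac_cubic f i (mono [tuple x; y]) =
    \sum_c e c (f (mono [tuple om i c; x; y])).
Proof.
rewrite !ffunE; apply: eq_bigr => c _; rewrite mono_consE.
by congr (e c (f (mono _))); apply: val_inj.
Qed.

(** D_i D_i is scalar, hence D_i D_i D_j f = D_j D_i D_i f. *)
Lemma dirac_compat_cubic f : dirac_compat (dirac_cubic f) = 0.
Proof.
apply/ffunP => i; rewrite [LHS]ffunE [RHS]ffunE.
under eq_bigr => a _ do under eq_bigr => b _ do rewrite !dirac_cubicE !linearB.
under eq_bigr => a _ do rewrite sumrB.
rewrite sumrB clifford_trace => [|a b]; last first.
  apply: eq_bigr => c _; congr (e c (f _)); apply/mono_eqP.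
  by rewrite /= perm_cons (perm_catC [:: _] [:: _]).
apply/eqP; rewrite subr_eq0; apply/eqP.
under [RHS]eq_bigr => a _.
  rewrite (_ : \sum_b _ = e a (\sum_b \sum_c
     e b (e c (f (mono [tuple om i c; om (rev_ord i) a; om i b])))));
    last first.
    rewrite linear_sum; apply: eq_bigr => b _; congr (e a _).
    exact: linear_sum.
  rewrite clifford_trace => [|b c]; last first.
    congr (f _); apply/mono_eqP.
    rewrite /= (perm_catCA [:: _] [:: _]) perm_sym (perm_catCA [:: _] [:: _]).
    by rewrite perm_cons (perm_catC [:: _] [:: _]).
  rewrite linearN linear_sum.
  over.
rewrite sumrN; congr (- _); rewrite exchange_big; apply: eq_bigr => a _.
apply: eq_bigr => b _; congr (e a (f _)); apply/mono_eqP.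
by rewrite /= (perm_catCA [:: _] [:: _]).
Qed.

Hypothesis n_gt0 : (0 < n)%N.

(** A preimage of [h] is supported on the square of a single variable in each
    component, since D_i D_i maps that square to a multiple of -1. *)
Lemma dirac_compat_surj h : exists g, dirac_compat g = h.
Proof.
pose a0 := Ordinal n_gt0; pose sq i := mono [tuple om i a0; om i a0].
pose g : {ffun 'I_2 -> {ffun monomial I 2 -> S}} :=
  [ffun i => [ffun t => if t == sq (rev_ord i) then - h (rev_ord i) else 0]].
have sqP i x y : (mono [tuple x; y] == sq i) = (x == om i a0) && (y == om i a0).
  apply/eqP/andP => [/mono_eqP/perm_mem xy | [/eqP-> /eqP->] //].
  have := xy x; have := xy y; rewrite !inE !eqxx !orbT !orbb.
  by move=> /esym-> /esym->.
have gE i x y : g i (mono [tuple x; y]) =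
    if (x == om (rev_ord i) a0) && (y == om (rev_ord i) a0)
    then - h (rev_ord i) else 0.
  by rewrite !ffunE sqP.
have omE i j a b : (om i a == om j b) = (a == b) && (i == j) by [].
have neq_rev (i : 'I_2) : (i == rev_ord i) = false by case: i => [[|[|]]].
exists g; apply/ffunP => i; rewrite ffunE.
transitivity
  (\sum_a \sum_b e a (e b (if (a == a0) && (b == a0) then - h i else 0))).
  apply: eq_bigr => a _; apply: eq_bigr => b _.
  by rewrite !gE rev_ordK !omE !eqxx neq_rev !andbT !andbF subr0.
rewrite (bigD1 a0) //= (bigD1 a0) //=.
rewrite clifford_sqr opprK.
rewrite !big1 ?addr0 // => [a /negPf->|b /negPf->]; last by rewrite !linear0.
by rewrite big1 // => b _; rewrite !linear0.
Qed.

(** The image of [dirac_cubic] lies in the kernel of the surjection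
    [dirac_compat], which has codimension 2 dim S. *)
Lemma dim_ker_dirac_cubic_ge :
  (#|{: monomial I 3}| * s + 2 * s <=
   \dim (lker (linfun dirac_cubic)) + 2 * (#|{: monomial I 2}| * s))%N.
Proof.
have sur : limg (linfun dirac_compat) = fullv.
  apply/eqP; rewrite eqEsubv subvf; apply/subvP => h _.
  have [g <-] := dirac_compat_surj h.
  by apply/memv_imgP; exists g; rewrite ?memvf ?lfunE.
have := limg_ker_dim (linfun dirac_cubic) fullv.
have := limg_ker_dim (linfun dirac_compat) fullv.
rewrite sur !capfv !dim_ffun !card_ord => <- <-.
rewrite -addnA leq_add2l leq_add2r; apply: dimvS.
apply/subvP => _ /memv_imgP[f _ ->].
by rewrite memv_ker !lfunE /= dirac_compat_cubic.
Qed.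

(** The value is the symmetric tensor of [f] only when [f] is a solution:
    [vsproj] projects the rows onto the tableau otherwise. *)
Definition cubic_tensor (f : {ffun monomial I 3 -> S}) :
    {ffun I -> {ffun I -> subvs_of A}} :=
  [ffun x => [ffun y => vsproj A [ffun z => f (mono [tuple x; y; z])]]].

Fact cubic_tensor_is_linear : linear cubic_tensor.
Proof.
move=> c f f'; apply/ffunP => x; apply/ffunP => y; rewrite !ffunE.
by rewrite -linearP; congr vsproj; apply/ffunP => z; rewrite !ffunE.
Qed.

HB.instance Definition _ :=
  GRing.isLinear.Build R[i] _ _ *:%R cubic_tensor cubic_tensor_is_linear.

Lemma cubic_tensorE f x y z : dirac_cubic f = 0 ->
  vsval (cubic_tensor f x y) z = f (mono [tuple x; y; z]).
Proof.
move=> Df0; rewrite !ffunE vsprojK ?ffunE //; apply/mem_dirac_tableau => i.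
have /ffunP/(_ i)/ffunP/(_ (mono [tuple x; y])) := Df0.
rewrite dirac_cubicE !ffunE => Df0i; rewrite -[RHS]Df0i; apply: eq_bigr => a _.
rewrite ffunE; congr (e a (f _)); apply/mono_eqP.
by rewrite /= (perm_catC [:: _; _] [:: _]).
Qed.

Lemma dim_ker_dirac_cubic_le_prolongation :
  (\dim (lker (linfun dirac_cubic)) <=
   \dim (prolongation (prolongation_tableau A)))%N.
Proof.
rewrite -(@limg_dim_eq _ _ _ (linfun cubic_tensor)).
  apply: dimvS; apply/subvP => _ /memv_imgP[f + ->].
  rewrite memv_ker !lfunE /= => /eqP Df0.
  rewrite memv_cap; apply/andP; split.
    apply/mem_sym2_tensor => x y; apply/val_inj/ffunP => z.
    rewrite !cubic_tensorE //; congr (f _); apply/mono_eqP.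
    by rewrite /= (perm_catCA [:: _] [:: _]).
  apply/mem_tensor_sub => x; apply/mem_prolongation_tableau => y z.
  rewrite !cubic_tensorE //; congr (f _); apply/mono_eqP.
  by rewrite /= perm_cons (perm_catC [:: _] [:: _]).
apply/eqP; rewrite -subv0; apply/subvP => f.
rewrite memv_cap !memv_ker !lfunE /=.
move=> /andP[/eqP Df0 /eqP Tf0]; rewrite memv0; apply/eqP/ffunP => t.
rewrite -[t]factorsK ffunE; case: (factors t) => [[|x [|y [|z []]]] // size_t].
have := cubic_tensorE x y z Df0; rewrite Tf0 !ffunE => ->.
by congr (f (mono _)); apply: val_inj.
Qed.

End DiracPolynomials.

(** * A criterion for the first prolongation to be involutive *)

Section Criterion.

Variables (R : realType) (I : finType) (W : vectType R[i]).
Variable B : {vspace {ffun I -> W}}.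
Local Notation s := (\dim (fullv : {vspace W})).
Local Notation PB := (prolongation_tableau B).

Lemma dim_prolongation_le (U : vectType R[i]) (C : {vspace {ffun I -> U}}) :
  (\dim (prolongation C) <= \dim (prolongation_tableau C))%N.
Proof.
set V := prolongation_tableau C.
rewrite -(limg_ker_dim (linfun (@tensor_incl R I _ C)) V).
apply: leq_trans (leq_addl _ _); apply: dimvS; apply/subvP => T PT.
have [T' _ defT] :
    exists2 T', T' \in fullv & T = linfun (@tensor_incl R I _ C) T'.
  by apply/memv_imgP; move: PT; rewrite memv_cap => /andP[].
by rewrite defT in PT *; apply: memv_img; rewrite -memv_preim.
Qed.

Variables (m : nat) (u : #|I|.-tuple {ffun I -> R^o}).
Hypotheses (defN : #|I| = m.+3) (basis_u : basis_of fullv u).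
Hypothesis B_tail : flag_part B u m.+1 = 0%VS.
Hypothesis PB_tail : flag_part PB u m = 0%VS.

(** Cartan's inequality adds dim (flag_part B u (m - k - 1)) <= (k + 2) s to the
    bound for [k], as this part of the flag is k + 2 steps before the zero part
    of index m + 1. *)
Lemma dim_flag_prolongation_tail k : (k <= m)%N ->
  (2 * \dim (flag_part PB u (m - k)) <= k * (k + 3) * s)%N.
Proof.
have arith (p d x y z : nat) : (y <= p.+2 * d -> z <= x + y ->
    2 * x <= p * (p + 3) * d -> 2 * z <= p.+1 * (p.+1 + 3) * d)%N by nia.
elim: k => [_|k IHk ltkm]; first by rewrite subn0 PB_tail dimv0.
have ltN : (m - k.+1 < #|I|)%N.
  by rewrite defN; apply: leq_ltn_trans (leq_subr _ _) _; rewrite ltnW.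
have := dim_flag_prolongation basis_u B (Ordinal ltN).
rewrite /= -subSn // subSS.
have := @dim_flag_part_tail _ _ _ _ basis_u _ B m.+1 2 _ B_tail k.+2 ltkm.
rewrite subSS addn2 -defN => /(_ erefl) leB lePB.
have := IHk (ltnW ltkm); move: leB lePB.
exact: arith.
Qed.

Lemma sum_flag_prolongation :
  (6 * \sum_(0 <= i < #|I|) \dim (flag_part PB u i) <=
     m * (m + 1) * (m + 5) * s)%N.
Proof.
have PB0 i : (m <= i)%N -> \dim (flag_part PB u i) = 0%N.
  by move=> lemi; apply/eqP; rewrite dimv_eq0 -subv0 -PB_tail flag_part_anti.
have lemN : (m <= #|I|)%N by rewrite defN -addn3 leq_addr.
rewrite (@big_cat_nat _ _ _ m) //= [X in (_ + X)%N]big_nat_cond.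
rewrite [X in (_ + X)%N]big1 => [|i]; last by rewrite andbT => /andP[/PB0].
rewrite addn0 big_nat_rev big_mkord /= add0n.
have: (6 * \sum_(i < m) \dim (flag_part PB u (m - i.+1)) <=
   \sum_(i < m) 3 * (i.+1 * (i.+1 + 3) * s))%N.
  rewrite big_distrr; apply: leq_sum => i _ /=.
  rewrite (_ : 6 = 3 * 2)%N // -mulnA leq_mul2l /=.
  exact: dim_flag_prolongation_tail.
move/leq_trans; apply; clear.
elim: m => [|k IHk]; first by rewrite big_ord0.
rewrite big_ord_recr /=.
apply: leq_trans (leq_add IHk (leqnn _)) _; nia.
Qed.

(** Cartan's inequality for the prolongation bounds the dimension of the second
    prolongation by the sum estimated in [sum_flag_prolongation]; a lower bound
    that meets this estimate forces equality throughout. *)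
Lemma prolongation_involutive_of_dim_ge :
  (m * (m + 1) * (m + 5) * s <= 6 * \dim (prolongation PB))%N ->
  involutive_tableau PB.
Proof.
move=> le_dim; exists u => //.
have -> : \dim PB = \dim (flag_part PB u 0) by rewrite flag_part0.
rewrite -(@big_ltn _ _ _ 0 #|I|) ?defN //.
apply/eqP; rewrite eqn_leq; apply/andP; split.
  apply: leq_trans (dim_prolongation_le PB) _.
  rewrite -[X in (\dim X <= _)%N](flag_part0 basis_u).
  exact: dim_flag_prolongation_le_sum.
rewrite -(leq_pmul2l (isT : 0 < 6)%N).
exact: leq_trans sum_flag_prolongation le_dim.
Qed.

End Criterion.

(** * Bases with a prescribed tail *)

Section Flag.

Variables (R : realType) (I : finType).

Lemma span_tensor_consP (W : vectType R[i]) (v : {ffun I -> R^o}) s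
    (T : {ffun I -> W}) :
  T \in span_tensor W (v :: s) ->
  exists w, exists2 T', T' \in span_tensor W s & T = pure_tensor v w + T'.
Proof.
rewrite /span_tensor big_cons => /memv_addP[_ /memv_imgP[w _ ->] [T' sT' ->]].
by exists w; exists T' => //; rewrite lfunE.
Qed.

Variables (p q r t : I).
Hypotheses (pqr_uniq : uniq [:: p; q; r]) (t_notin : t \notin [:: p; q; r]).

(** The covector [delta p + delta t] takes the place of [delta p], because a tail
    of three coordinate covectors is too special for the Dirac equations. *)
Definition adapted_basis : seq {ffun I -> R^o} :=
  [seq delta R x | x <- enum I & x \notin [:: p; q; r]] ++
  [:: delta R p + delta R t; delta R q; delta R r].

Lemma size_filter_notin :
  (size [seq x <- enum I | x \notin [:: p; q; r]] + 3)%N = #|I|.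
Proof.
rewrite cardE -(count_predC (mem [:: p; q; r]) (enum I)) addnC -!size_filter.
congr (_ + _)%N; rewrite -[3%N]/(size [:: p; q; r]); apply/perm_size/uniq_perm.
- exact: pqr_uniq.
- by rewrite filter_uniq ?enum_uniq.
by move=> x; rewrite mem_filter mem_enum andbT.
Qed.

Lemma size_adapted_basis : size adapted_basis = #|I|.
Proof. by rewrite size_cat size_map /= size_filter_notin. Qed.

Lemma drop_adapted_basis m : #|I| = m.+3 ->
  drop m adapted_basis = [:: delta R p + delta R t; delta R q; delta R r].
Proof.
rewrite -size_filter_notin addn3 => -[<-].
by rewrite drop_size_cat // size_map.
Qed.

Lemma adapted_basisP : basis_of fullv adapted_basis.
Proof.
rewrite basisEdim size_adapted_basis dim_ffun dimvf /= muln1 leqnn andbT.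
apply/subvP => g _; rewrite [g]covector_sum_delta; apply: memv_suml => x _.
apply: memvZ.
have mem_other y : y \notin [:: p; q; r] -> delta R y \in <<adapted_basis>>%VS.
  move=> y_pqr; apply: memv_span; rewrite mem_cat; apply/orP; left.
  by apply: map_f; rewrite mem_filter y_pqr mem_enum.
have [| /mem_other//] := boolP (x \in [:: p; q; r]).
have mem_tail v : v \in [:: delta R p + delta R t; delta R q; delta R r] ->
    v \in <<adapted_basis>>%VS.
  by move=> v_tail; apply: memv_span; rewrite mem_cat v_tail orbT.
rewrite !inE => /or3P[] /eqP->;
  [ | by apply: mem_tail; rewrite !inE eqxx ?orbT ..].
rewrite -[delta R p](addrK (delta R t)) memvB ?mem_other //.
by apply: mem_tail; rewrite inE eqxx.
Qed.

Lemma span_tensor_tail3 (W : vectType R[i]) (T : {ffun I -> W}) :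
  T \in span_tensor W [:: delta R p + delta R t; delta R q; delta R r] ->
  T t = T p /\ forall x, x \notin [:: p; q; r; t] -> T x = 0.
Proof.
move=> /span_tensor_consP[w1 [T1 /span_tensor_consP[w2 [T2]]]].
move=> /span_tensor_consP[w3 [T3]]; rewrite /span_tensor big_nil memv0.
move=> /eqP-> -> -> ->; move: pqr_uniq t_notin; rewrite /= !inE !negb_or !andbT.
move=> /andP[/andP[pq pr] qr] /and3P[tp tq tr]; split=> [|x].
  rewrite !ffunE !eqxx (negPf tp) (negPf tq) (negPf tr) [p == t]eq_sym.
  by rewrite (negPf tp) (negPf pq) (negPf pr) !addr0 add0r.
rewrite !inE !negb_or => /and4P[/negPf xp /negPf xq /negPf xr /negPf xt].
by rewrite !ffunE xp xq xr xt addr0 rmorph0 !scale0r !addr0.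
Qed.

Lemma span_tensor_tail2 (W : vectType R[i]) (T : {ffun I -> W}) :
  T \in span_tensor W [:: delta R q; delta R r] ->
  forall x, x \notin [:: q; r] -> T x = 0.
Proof.
move=> /span_tensor_consP[w2 [T2 /span_tensor_consP[w3 [T3]]]].
rewrite /span_tensor big_nil memv0 => /eqP-> -> -> x.
rewrite !inE negb_or => /andP[/negPf xq /negPf xr].
by rewrite !ffunE xq xr rmorph0 !scale0r !addr0.
Qed.

End Flag.

(** * The flag adapted to the Dirac tableau *)

Section DiracFlag.

Variables (R : realType) (n : nat) (S : vectType R[i]) (e : 'I_n -> 'End(S)).
Hypothesis cliff : forall (a b : 'I_n) (s : S),
  e a (e b s) + e b (e a s) = (- 2 * (a == b)%:R) *: s.

Local Notation I := (coframe n 2).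
Local Notation A := (dirac_tableau 2 e).
Local Notation PA := (prolongation_tableau A).
Local Notation s := (\dim (fullv : {vspace S})).
Local Notation om i a := (inl (a, i) : I).

Lemma clifford_inj a v : e a v = 0 -> v = 0.
Proof.
move=> eav0; apply/eqP; rewrite -oppr_eq0 -(clifford_sqr cliff a) eav0.
by rewrite linear0.
Qed.

Lemma clifford_solve a b v w : e a v + e b w = 0 -> v = e a (e b w).
Proof.
move=> /(congr1 (e a)); rewrite linearD /= (clifford_sqr cliff) linear0.
by move/eqP; rewrite addrC subr_eq0 => /eqP.
Qed.

(** In a Clifford module, e_a e_b and e_a e_c do not commute when a, b, c are
    distinct: their commutator is 2 e_b e_c, which is invertible. *)
Lemma clifford_commutator_inj a b c v : a != b -> a != c -> b != c ->
  e a (e b (e a (e c v))) = e a (e c (e a (e b v))) -> v = 0.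
Proof.
move=> ab ac bc.
rewrite (clifford_anticomm cliff (e c v) (_ : b != a)) 1?eq_sym //.
rewrite (clifford_anticomm cliff (e b v) (_ : c != a)) 1?eq_sym //.
rewrite !linearN /= !(clifford_sqr cliff) !opprK (clifford_anticomm cliff v bc).
move/eqP; rewrite -subr_eq0 -opprD oppr_eq0 -mulr2n -scaler_nat scaler_eq0.
by rewrite pnatr_eq0 /= => /eqP/clifford_inj/clifford_inj.
Qed.

Variables a1 a2 a3 : 'I_n.
Hypotheses (a12 : a1 != a2) (a13 : a1 != a3) (a23 : a2 != a3).

(* The last covectors of the flag are omega_p + omega_t, omega_q, omega_r.
   Without omega_t, which has the row index of omega_r, the equation of that row
   would make the derivative along omega_r zero, and one of the two Clifford
   elements that should not commute would be zero. *)
Let i0 : 'I_2 := ord0.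
Let i1 : 'I_2 := ord_max.
Let p := om i0 a2.
Let q := om i0 a1.
Let r := om i1 a1.
Let t := om i1 a3.

Lemma dirac_tableau_tail2 psi : psi \in A ->
  (forall x, x \notin [:: q; r] -> psi x = 0) -> psi = 0.
Proof.
move=> /mem_dirac_tableau Apsi psi0.
have psi1 i : psi (om i a1) = 0.
  apply: (@clifford_inj a1); rewrite -[RHS](Apsi i) (bigD1 a1) //=.
  rewrite big1 ?addr0 // => a neq_a; rewrite psi0 ?linear0 // !inE negb_or.
  by apply/andP; split; apply: contra neq_a => /eqP[->].
apply/ffunP => x; rewrite [RHS]ffunE.
have [|/psi0//] := boolP (x \in [:: q; r]).
by rewrite !inE => /orP[] /eqP->; apply: psi1.
Qed.

(** A linear form in the last three covectors has equal coefficients at [p] and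
    [t]; the Dirac equations express its other coefficients by this one. *)
Lemma dirac_tableau_tail3 psi : psi \in A -> psi t = psi p ->
  (forall x, x \notin [:: p; q; r; t] -> psi x = 0) ->
  psi q = e a1 (e a2 (psi p)) /\ psi r = e a1 (e a3 (psi p)).
Proof.
move=> /mem_dirac_tableau Apsi psi_t psi0.
have omE i j a b : (om i a == om j b) = (a == b) && (i == j) by [].
split; [have := Apsi i0 | rewrite -psi_t; have := Apsi i1].
  rewrite (bigD1 a1) //= (bigD1 a2) 1?eq_sym //=.
  rewrite big1 ?addr0 => [|a /andP[n1 n2]].
    exact: clifford_solve.
  by rewrite psi0 ?linear0 // !inE !omE (negPf n1) (negPf n2) !andbF.
rewrite (bigD1 a1) //= (bigD1 a3) 1?eq_sym //= big1 ?addr0 => [|a /andP[n1 n2]].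
  exact: clifford_solve.
by rewrite psi0 ?linear0 // !inE !omE (negPf n1) (negPf n2) !andbF.
Qed.

(** All second derivatives of a quadratic solution in the last three covectors
    are Clifford multiples of [f p p], and [f q r], computed from row [q] and
    from row [r], gives a commutator that kills [f p p]. *)
Lemma prolongation_dirac_tail3 T : T \in PA -> T t = T p ->
  (forall x, x \notin [:: p; q; r; t] -> T x = 0) -> T = 0.
Proof.
move=> /mem_prolongation_tableau symT T_t T0.
pose f x y := vsval (T x) y.
have f0 x y : x \notin [:: p; q; r; t] -> f x y = 0.
  by move=> x_tail; rewrite /f T0 // linear0 ffunE.
have f_t y : f t y = f p y by rewrite /f T_t.
have f_qr x : f x q = e a1 (e a2 (f x p)) /\ f x r = e a1 (e a3 (f x p)).
  apply: dirac_tableau_tail3; first exact: subvsP.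
    by rewrite (symT x t) (symT x p) T_t.
  by move=> y y_tail; rewrite (symT x) [LHS]f0.
have fpp : f p p = 0.
  apply: (clifford_commutator_inj a12 a13 a23).
  have [pq pr] := f_qr p; have [_ qr] := f_qr q; have [rq _] := f_qr r.
  rewrite -pr -(symT r p : f r p = f p r) -rq (symT r q : f r q = f q r) qr.
  by rewrite (symT q p : f q p = f p q) pq.
have f_p x : f x p = 0.
  have [|/f0//] := boolP (x \in [:: p; q; r; t]).
  have [pq pr] := f_qr p; move: pq pr; rewrite fpp !linear0 => pq pr.
  rewrite !inE => /or4P[] /eqP->; rewrite ?f_t //.
    by rewrite (symT q p : f q p = f p q).
  by rewrite (symT r p : f r p = f p r).
apply/ffunP => x; apply/val_inj/ffunP => y; rewrite ffunE linear0 [RHS]ffunE.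
rewrite symT -/(f y x).
have [|/f0 fx0] := boolP (x \in [:: p; q; r; t]); last first.
  by rewrite (symT y x : f y x = f x y).
have [yq yr] := f_qr y; move: yq yr; rewrite f_p !linear0 => yq yr.
rewrite !inE => /or4P[] /eqP-> //.
by rewrite (symT y t : f y t = f t y) f_t (symT p y : f p y = f y p).
Qed.

(** The bounds agree because
    6 (C(m+5, 3) - 2 C(m+4, 2) + 2) = m (m + 1) (m + 5). *)
Lemma dirac_prolongation_involutive : involutive_tableau PA.
Proof.
have omE i j a b : (om i a == om j b) = (a == b) && (i == j) by [].
have pqr_uniq : uniq [:: p; q; r].
  by rewrite /= !inE !omE [a2 == a1]eq_sym (negPf a12) !andbF.
have t_notin : t \notin [:: p; q; r].
  by rewrite !inE !omE [a3 == a1]eq_sym (negPf a13) andbF.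
have [m defN] : exists m, #|I| = m.+3.
  by exists (size [seq x <- enum I | x \notin [:: p; q; r]]);
     rewrite -addn3 size_filter_notin.
have size_u := introT eqP (size_adapted_basis R t pqr_uniq).
have tail3 := drop_adapted_basis R t pqr_uniq defN.
apply: (@prolongation_involutive_of_dim_ge _ _ _ A m (Tuple size_u) defN).
- exact: adapted_basisP.
- apply/eqP; rewrite -subv0; apply/subvP => psi; rewrite memv_cap memv0.
  rewrite -[m.+1]add1n -drop_drop tail3 /=.
  move=> /andP[Apsi /span_tensor_tail2 psi0].
  by apply/eqP; apply: dirac_tableau_tail2 psi0.
- apply/eqP; rewrite -subv0; apply/subvP => T; rewrite memv_cap memv0 tail3.
  move=> /andP[PAT /(span_tensor_tail3 pqr_uniq t_notin)[T_t T0]].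
  by apply/eqP; apply: prolongation_dirac_tail3.
have n_gt0 : (0 < n)%N by apply: leq_trans (ltn_ord a1).
have := dim_ker_dirac_cubic_ge cliff n_gt0.
have := dim_ker_dirac_cubic_le_prolongation e; rewrite !card_monomial ?defN //=.
have := bin_ffact (3 + m.+2) 3; have := bin_ffact (2 + m.+2) 2.
rewrite !ffactnS !ffactn0 /= -[3`!]/6%N -[2`!]/2%N.
have arith (b c d K P : nat) :
    (b * 2 = (2 + m.+2) * ((1 + m.+2) * 1) ->
     c * 6 = (3 + m.+2) * ((2 + m.+2) * ((1 + m.+2) * 1)) ->
     K <= P -> c * d + 2 * d <= K + 2 * (b * d) ->
     m * (m + 1) * (m + 5) * d <= 6 * P)%N.
  move=> defb defc leKP leK.
  have : (c * 6 * d + 12 * d <= 6 * P + 6 * (b * 2 * d))%N by lia.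
  by rewrite defb defc; nia.
exact: arith.
Qed.

End DiracFlag.

Theorem theorem3 (R : realType) (n : nat) (hn : (3 <= n)%N)
    (S : vectType R[i]) (e : 'I_n -> 'End(S)) (hS : spinor_module e) :
  involutive_tableau (prolongation_tableau (dirac_tableau 2 e)).
Proof.
have [cliff _ _] := hS.
pose a1 := Ordinal (leq_trans (isT : 0 < 3)%N hn).
pose a2 := Ordinal (leq_trans (isT : 1 < 3)%N hn).
pose a3 := Ordinal (leq_trans (isT : 2 < 3)%N hn).
exact: (@dirac_prolongation_involutive _ _ _ _ cliff a1 a2 a3).
Qed.
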